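(* Let $\Gamma$ be a reduced injective labeled oriented forest (LOF) such that all sub-LOTs of $\Gamma$ are boundary reduced. Then the LOF-complex $K(\Gamma)$ has the lbf-property.
   Context: **LOGs.** A labeled oriented graph (LOG) $\Gamma=(E,V,s,t,\lambda)$ consists of finite sets $E$ (edges) and $V$ (vertices) and maps $s,t,\lambda\colon E\to V$ (source, target, label). It is a labeled oriented forest (LOF) if the underlying graph (edge $e$ joins $s(e)$ and $t(e)$) is a forest, and a labeled oriented tree (LOT) if the underlying graph is a tree. A sub-LOG $\Gamma_0=(E_0,V_0)\subseteq\Gamma$ is a subgraph with $E_0\neq\emptyset$ and $\lambda(E_0)\subseteq V_0$; it is a sub-LOT if it is a LOT. A LOG is boundary reduced if every vertex $v$ of valency 1 satisfies $v=\lambda(e)$ for some edge $e$ of that LOG. It is interior reduced if for every vertex $v$ no two edges starting or terminating at $v$ carry the same label. It is compressed if $\lambda(e)\ne s(e)$ and $\lambda(e)\neq t(e)$ for every edge $e$. It is reduced if it is boundary reduced, interior reduced and compressed. It is injective if $\lambda\colon E\to V$ is injective. The LOG complex $K(\Gamma)$ is the standard 2-complex of the presentation $\langle V \mid s(e)\lambda(e)=\lambda(e)t(e),\ e\in E\rangle$: it has one vertex, one oriented edge for each $x\in V$, and for each $e\in E$ a 2-cell attached along $s(e)\lambda(e)t(e)^{-1}\lambda(e)^{-1}$. **Link and lbf-property.** Let $V=\{x_1,\dots,x_n\}$. The link $\Lambda=lk(K(\Gamma))$ of the unique vertex is the undirected (multi)graph with vertices $x_1^+,\dots,x_n^+,x_1^-,\dots,x_n^-$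 ($x_i^+$ is near the start and $x_i^-$ near the end of the edge $x_i$), whose edges are the corners of the 2-cells: each $e\in E$ with $s(e)=x_i$, $t(e)=x_j$, $\lambda(e)=x_k$ contributes four corners, one joining $x_i^+,x_k^+$, one joining $x_k^-,x_j^-$, one joining $x_i^-,x_k^+$, one joining $x_k^-,x_j^+$. $\Lambda(v_1,\dots,v_r)$ denotes the full subgraph of $\Lambda$ on the vertices $v_1,\dots,v_r$. $K(\Gamma)$ has the lbf-property (local bi-forest property) if there is a choice of signs $\epsilon_i\in\{+,-\}$, $1\le i\le n$, such that $\Lambda(x_1^{\epsilon_1},\dots,x_n^{\epsilon_n})$ and $\Lambda(x_1^{-\epsilon_1},\dots,x_n^{-\epsilon_n})$ are forests. *)

(* Defs.v *)
From mathcomp Require Import all_boot.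

Set Implicit Arguments.
Unset Strict Implicit.
Unset Printing Implicit Defensive.

(** Finite undirected multigraphs (loops and parallel edges allowed) are given
    by an incidence map [ends : E -> V * V], the order of the two endpoints
    being irrelevant.  A subgraph is a pair of sets [A : {set V}], [B : {set E}]
    such that the endpoints of the edges in [B] lie in [A]. *)
Section Multigraph.

Variables (V E : finType) (ends : E -> V * V).
Implicit Types (A : {set V}) (B : {set E}).

Definition joins (e : E) (u v : V) : bool :=
  (ends e == (u, v)) || (ends e == (v, u)).

Definition subgraph A B : Prop :=
  forall e, e \in B -> ((ends e).1 \in A) /\ ((ends e).2 \in A).

(** [[:: (v_1, e_1); ...; (v_k, e_k)]], [k >= 1], with distinct vertices and
    distinct edges, [e_i] joining [v_i] to [v_(i+1)] and [e_k] joining [v_k] to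
    [v_1].  A loop is a cycle with [k = 1], two parallel edges form a cycle
    with [k = 2]. *)
Definition is_cycle (c : seq (V * E)) : bool :=
  [&& c != [::], uniq (unzip1 c), uniq (unzip2 c)
    & cycle (fun p q => joins p.2 p.1 q.1) c].

Definition is_forest A B : Prop :=
  subgraph A B /\
  ~ exists2 c : seq (V * E), is_cycle c & {subset unzip2 c <= B}.

Definition adjacent B : rel V := fun u v => [exists e in B, joins e u v].

Definition is_tree A B : Prop :=
  [/\ is_forest A B, A != set0
    & {in A &, forall u v, connect (adjacent B) u v}].

(** A loop counts twice. *)
Definition valency B (v : V) : nat :=
  #|[set e in B | (ends e).1 == v]| + #|[set e in B | (ends e).2 == v]|.

Definition full_edges A : {set E} :=
  [set e | ((ends e).1 \in A) && ((ends e).2 \in A)].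

End Multigraph.

Record LOG := MkLOG {
  vertex : finType;
  edge : finType;
  src : edge -> vertex;
  tgt : edge -> vertex;
  lab : edge -> vertex }.

Arguments src {l} _.
Arguments tgt {l} _.
Arguments lab {l} _.

Section LabeledOrientedGraphs.

Variable G : LOG.
Implicit Types (V : {set vertex G}) (E : {set edge G}).

Definition log_ends (e : edge G) : vertex G * vertex G := (src e, tgt e).

Definition is_LOF : Prop := is_forest log_ends setT setT.

Definition is_subLOG V0 E0 : Prop :=
  [/\ subgraph log_ends V0 E0, E0 != set0
    & forall e, e \in E0 -> lab e \in V0].

Definition is_subLOT V0 E0 : Prop :=
  is_subLOG V0 E0 /\ is_tree log_ends V0 E0.

(** Boundary reducedness of the LOG [(V0, E0)]: both the valency and the
    labels are those of [(V0, E0)], not of the ambient [G]. *)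
Definition boundary_reduced_on V0 E0 : Prop :=
  forall v, v \in V0 -> valency log_ends E0 v = 1 ->
  exists2 e, e \in E0 & v = lab e.

Definition boundary_reduced : Prop := boundary_reduced_on setT setT.

(** Two edges both starting, or both terminating, at the same vertex. *)
Definition interior_reduced : Prop :=
  forall (v : vertex G) (e f : edge G), e != f ->
  (src e = v /\ src f = v) \/ (tgt e = v /\ tgt f = v) ->
  lab e <> lab f.

Definition compressed : Prop :=
  forall e : edge G, lab e <> src e /\ lab e <> tgt e.

Definition reduced : Prop :=
  [/\ boundary_reduced, interior_reduced & compressed].

Definition injective_LOG : Prop := injective (@lab G).

(** In a letter [(x, b)], [b = true] stands for [x] and [b = false] for
    [x^-1]; in a vertex [(x, b)] of the link, [b = true] stands for [x^+] and
    [b = false] for [x^-]. *)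

(** The attaching word [s(e) lab(e) t(e)^-1 lab(e)^-1]. *)
Definition attaching_word (e : edge G) : 4.-tuple (vertex G * bool) :=
  [tuple (src e, true); (lab e, true); (tgt e, false); (lab e, false)].

(** The letter [x] leaves the base vertex through [x^+] and returns to it
    through [x^-]; for [x^-1] it is the other way round. *)
Definition letter_first (l : vertex G * bool) : vertex G * bool := l.
Definition letter_last (l : vertex G * bool) : vertex G * bool :=
  (l.1, ~~ l.2).

(** The corner [(e, i)] of the 2-cell [e] lies between the letters [i] and
    [i + 1] (cyclically) of its attaching word. *)
Definition link_ends (c : edge G * 'I_4) :
    (vertex G * bool) * (vertex G * bool) :=
  (letter_last (tnth (attaching_word c.1) c.2),
   letter_first (tnth (attaching_word c.1) (ordS c.2))).

Lemma link_endsE (e : edge G) :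
  [seq link_ends (e, i) | i <- ord_enum 4] =
  [:: ((src e, false), (lab e, true)); ((lab e, false), (tgt e, false));
      ((tgt e, true), (lab e, false)); ((lab e, true), (src e, true))].
Proof.
have -> : ord_enum 4 = [:: @Ordinal 4 0 isT; @Ordinal 4 1 isT;
                           @Ordinal 4 2 isT; @Ordinal 4 3 isT].
  by apply: (inj_map val_inj); rewrite val_ord_enum.
by rewrite /= /link_ends /= !(tnth_nth (src e, true)).
Qed.

Definition full_link_is_forest (A : {set vertex G * bool}) : Prop :=
  is_forest link_ends A (full_edges link_ends A).

Definition lbf_property : Prop :=
  exists eps : vertex G -> bool,
    full_link_is_forest [set (x, eps x) | x : vertex G] /\
    full_link_is_forest [set (x, ~~ eps x) | x : vertex G].

End LabeledOrientedGraphs.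

(* Main.v *)
Require Import Defs.
From mathcomp Require Import all_boot.

(** The link of [K(G)] turns the choice of signs into a choice of orientations.
    For an edge [e] with label [c], the vertex [c^+] of the link is joined to
    both copies of [src e], and [c^-] to both copies of [tgt e].  As [lab] is
    injective, the half of the link selected by [eps] therefore has one edge per
    labeled vertex [c = lab e]: it joins [c] to [src e] if [eps c] is [+], and
    to [tgt e] otherwise.  In other words, draw two arcs [c -> src e] and
    [c -> tgt e] for each [e]; a choice of signs splits these arcs into two
    partial functions on the vertices, one for each half of the link, and a half
    is a forest as soon as its partial function has no periodic point.

    So the arcs have to be partitioned into two branchings directed towards the
    vertices that are not labels.  By Edmonds' disjoint branchings theorem
    ([edmonds_split]) this is possible when every nonempty set [X] of labels has
    at least two outgoing arcs.  Suppose that some [X] has at most one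
    ([label_cut_ge2]).  There are [#|X|] edges with label in [X], and since [G]
    is a forest at most [#|X| - 1] of them have both ends in [X].  Hence
    exactly one of them, [e], leaves [X], by a single end [y], and the others
    form a tree on [X].  Adding [e] and [y] gives a sub-LOT whose leaf [y] is
    not the label of any of its edges, so this sub-LOT is not boundary
    reduced. *)

Set Implicit Arguments.
Unset Strict Implicit.
Unset Printing Implicit Defensive.

(** * Edmonds' theorem on disjoint branchings *)

Section EdmondsBranchings.

Variables (T arc : finType) (tl hd : arc -> T) (R : {set T}).
Implicit Types (X Y A : {set T}) (B F : {set arc}).

Definition out_arcs B X : {set arc} :=
  [set a in B | (tl a \in X) && (hd a \notin X)].

Lemma out_arcs_submodular B X Y :
  #|out_arcs B (X :&: Y)| + #|out_arcs B (X :|: Y)|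
    <= #|out_arcs B X| + #|out_arcs B Y|.
Proof.
rewrite -cardsUI -[leqRHS]cardsUI; apply: leq_add; apply: subset_leq_card;
  apply/subsetP=> a; rewrite !inE;
  by move: (a \in B) (tl a \in X) (tl a \in Y) (hd a \in X) (hd a \in Y);
     do 5!case.
Qed.

Lemma out_arcsD1 B X a : out_arcs (B :\ a) X = out_arcs B X :\ a.
Proof. by apply/setP=> b; rewrite !inE -!andbA. Qed.

(** For [k = 1] this says that every vertex has a path in [B] to [R]: otherwise
    the vertices without one would form a set that no arc leaves. *)
Definition arcs_to_root k B : Prop :=
  forall X, X != set0 -> [disjoint X & R] -> k <= #|out_arcs B X|.

(** [F] is a branching towards [R] grown on the vertex set [A] so far, such that
    its removal costs only one of the [k.+1] arcs leaving each set. *)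
Definition partial_branching k B A F : Prop :=
  [/\ R \subset A, F \subset B,
      forall a, a \in F -> (tl a \in A) && (hd a \in A),
      forall X, X != set0 -> [disjoint X & R] -> X \subset A ->
        out_arcs F X != set0
    & arcs_to_root k (B :\: F)].

(** Removing [a] can only hurt the sets that it leaves, and these have an arc to
    spare by assumption. *)
Lemma partial_branching_add k B A F a :
    partial_branching k B A F -> a \in B :\: F -> tl a \notin A -> hd a \in A ->
    (forall Y, [disjoint Y & R] -> tl a \in Y -> hd a \notin Y ->
       k < #|out_arcs (B :\: F) Y|) ->
  partial_branching k B (tl a |: A) (a |: F).
Proof.
case=> RA FB endF outF rest aBF tlA hdA slack.
have aB : a \in B by move: aBF; rewrite inE => /andP[].
split.
- exact: subset_trans RA (subsetUr _ _).
- by rewrite subUset sub1set aB.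
- move=> b; rewrite !inE => /predU1P[->|/endF/andP[-> ->]];
    last by rewrite !orbT.
  by rewrite eqxx hdA orbT.
- move=> X X0 XR XA.
  have [tlX|tlX] := boolP (tl a \in X); last first.
    have /set0Pn[b bX] : out_arcs F X != set0.
      apply: outF => //; apply/subsetP=> x xX; move/subsetP/(_ x xX): XA.
      by rewrite in_setU1 => /predU1P[xE|//]; rewrite -xE xX in tlX.
    apply/set0Pn; exists b; move: bX.
    by rewrite !inE => /andP[-> ->]; rewrite orbT.
  have [hdX|hdX] := boolP (hd a \in X); last first.
    by apply/set0Pn; exists a; rewrite !inE eqxx tlX hdX.
  have /set0Pn[b] : out_arcs F (X :\ tl a) != set0.
    apply: outF.
    - apply/set0Pn; exists (hd a); rewrite !inE hdX andbT.
      by apply: contraNneq tlA => <-.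
    - by apply: disjointWl XR; exact: subD1set.
    - by rewrite subDset.
  rewrite !inE => /and3P[bF /andP[_ tlb] hdb].
  apply/set0Pn; exists b; rewrite !inE bF orbT tlb /=.
  have /andP[_ hdbA] := endF b bF.
  move: hdb; rewrite negb_and negbK => /orP[/eqP hE|//].
  by rewrite hE (negbTE tlA) in hdbA.
- move=> X X0 XR.
  have -> : B :\: (a |: F) = (B :\: F) :\ a.
    by apply/setP=> b; rewrite !inE negb_or andbA.
  rewrite out_arcsD1.
  have := cardsD1 a (out_arcs (B :\: F) X).
  have [aX|aX] := boolP (a \in out_arcs _ X); last first.
    by rewrite add0n => <-; apply: rest.
  move: aX; rewrite inE => /and3P[_ tlX hdX].
  by have := slack X XR tlX hdX => + E; rewrite E add1n ltnS.
Qed.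

(** An argument of Lovasz.  An arc entering [A] is usable unless it leaves a
    tight set, one with only [k] arcs left.  If there are tight sets not
    contained in [A], take a minimal one, [X].  More arcs leave [X :\: A] than
    [X], because no arc of [F] starts outside [A]; so some arc goes from
    [X :\: A] to [X :&: A].  If it left another tight set [Y], then by
    submodularity [X :&: Y] would be tight as well, and smaller than [X]. *)
Lemma partial_branching_extend k B A F :
    arcs_to_root k.+1 B -> partial_branching k B A F -> A != setT ->
  exists u, exists2 F', u \notin A & partial_branching k B (u |: A) F'.
Proof.
move=> Bk PB AT; have [RA FB endF _ rest] := PB.
have outA X : [disjoint X & A] -> out_arcs (B :\: F) X = out_arcs B X.
  move=> XA; apply/setP=> a; rewrite !inE.
  have [aF|//] := boolP (a \in F); have /andP[tlA _] := endF a aF.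
  by rewrite (disjointFl XA tlA) /= !andbF.
suff [a [aBF tlA hdA slack]] : exists a, [/\ a \in B :\: F, tl a \notin A,
    hd a \in A & forall Y, [disjoint Y & R] -> tl a \in Y -> hd a \notin Y ->
       k < #|out_arcs (B :\: F) Y|].
  by exists (tl a), (a |: F) => //; apply: partial_branching_add.
pose tight X := [&& [disjoint X & R], ~~ (X \subset A)
                  & #|out_arcs (B :\: F) X| <= k].
have [X0 tX0|notight] := pickP tight; last first.
  have /card_gt0P[a] : 0 < #|out_arcs (B :\: F) (~: A)|.
    rewrite outA; last by rewrite -setI_eq0 setIC setICr.
    apply: leq_ltn_trans (leq0n k) (Bk _ _ _).
      by apply: contraNneq AT => A0; rewrite -(setCK A) A0 setC0.
    by apply: disjointWr RA _; rewrite -setI_eq0 setIC setICr.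
  rewrite in_set => /and3P[aBF]; rewrite !inE negbK => tlA hdA.
  exists a; split=> // Y YR tlY _.
  have := notight Y; rewrite /tight YR /= => /negbT.
  rewrite negb_and negbK -ltnNge => /orP[/subsetP/(_ _ tlY)|//].
  by rewrite (negbTE tlA).
have [X /minsetP[tX minX] _] := minset_exists tX0.
have /and3P[XR XA Xk] := tX.
have XDA : X :\: A != set0 by rewrite setD_eq0.
have DXA : [disjoint X :\: A & A].
  by rewrite -setI_eq0 setIDAC setDE -setIA setICr setI0.
have : ~~ (out_arcs (B :\: F) (X :\: A) \subset out_arcs (B :\: F) X).
  apply: contraL Xk => /subset_leq_card; rewrite outA // -ltnNge.
  apply: leq_trans; apply: Bk => //.
  by apply: disjointWl XR; exact: subsetDl.
case/subsetPn=> a; rewrite in_set => /and3P[aBF].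
rewrite in_setD => /andP[tlA tlX].
rewrite in_setD in_set aBF tlX /= negb_and !negbK => hdX' hdX.
rewrite hdX orbF in hdX'.
exists a; split=> // Y YR tlY hdY; rewrite ltnNge; apply/negP=> Yk.
have XYR : [disjoint X :&: Y & R] by apply: disjointWl XR; exact: subsetIl.
have XUYR : [disjoint X :|: Y & R].
  by rewrite -setI_eq0 setIUl setU_eq0 !setI_eq0 XR.
have XUYk : k <= #|out_arcs (B :\: F) (X :|: Y)|.
  by apply: rest XUYR; apply/set0Pn; exists (tl a); rewrite inE tlX.
have XYE : X :&: Y = X.
  apply: minX; last exact: subsetIl.
  rewrite /tight XYR /=; apply/andP; split.
    by apply/subsetPn; exists (tl a) => //; rewrite inE tlX.
  rewrite -(leq_add2r k).
  apply: leq_trans (leq_add (leqnn _) XUYk) _.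
  apply: leq_trans (out_arcs_submodular _ _ _) _.
  exact: leq_add.
by move: hdX; rewrite -XYE inE (negbTE hdY) andbF.
Qed.

(** The inductive step of Edmonds' theorem: iterating it packs [k] disjoint
    branchings. *)
Lemma edmonds_split k B :
    arcs_to_root k.+1 B ->
  exists F, [/\ F \subset B, arcs_to_root 1 F & arcs_to_root k (B :\: F)].
Proof.
move=> Bk.
suff grow n A F : #|~: A| <= n -> partial_branching k B A F ->
    exists F', partial_branching k B setT F'.
  have [|F' [_ F'B _ outF' rest]] := grow #|~: R| R set0 (leqnn _).
    split=> //; first exact: sub0set.
    - by move=> a; rewrite inE.
    - move=> X X0 XR XsR.
      by move: X0; rewrite -(setIidPl XsR) setI_eq0 XR.
    - by move=> X X0 XR; rewrite setD0; apply: ltnW; apply: Bk.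
  by exists F'; split=> // X X0 XR; rewrite card_gt0; apply: outF' (subsetT X).
elim: n A F => [|n IH] A F.
  rewrite leqn0 cards_eq0 => /eqP A0 PB; exists F.
  by rewrite -(setCK A) A0 setC0 in PB.
move=> An PB; have [AT|AT] := eqVneq A setT; first by exists F; rewrite -AT.
have [u [F' uA]] := partial_branching_extend Bk PB AT.
apply: IH; rewrite setCU setIC -setDE.
by move: An; rewrite (cardsD1 u (~: A)) inE uA.
Qed.

End EdmondsBranchings.

(** * Counting edges and vertices in forests *)

Section ForestCounting.

Variables (V E : finType) (ends : E -> V * V).
Implicit Types (X : {set V}) (B : {set E}).

Definition acyclic B : Prop :=
  ~ exists2 c : seq (V * E), is_cycle ends c & {subset unzip2 c <= B}.

Lemma acyclicS B B' : B' \subset B -> acyclic B -> acyclic B'.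
Proof.
move=> /subsetP sB acB [c cyc cB]; apply: acB; exists c => // e /cB; exact: sB.
Qed.

Lemma joinsC e u v : joins ends e u v = joins ends e v u.
Proof. by rewrite /joins orbC. Qed.

Lemma joins_ends e : joins ends e (ends e).1 (ends e).2.
Proof. by rewrite /joins -surjective_pairing eqxx. Qed.

Lemma joins_full_edges (A : {set V}) e u v :
  joins ends e u v -> (e \in full_edges ends A) = (u \in A) && (v \in A).
Proof. by rewrite inE => /orP[]/eqP-> //=; rewrite andbC. Qed.

Lemma adjacent_sym B : symmetric (adjacent ends B).
Proof. by move=> u v; apply: eq_existsb => e; rewrite joinsC. Qed.

(** Induction on the path.  The control on the endpoints in the last clause is
    what makes the edges distinct: the first edge of the path contains [x],
    which no later vertex equals. *)
Lemma close_path B f x p z :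
    f \notin B -> joins ends f (last x p) z ->
    path (adjacent ends B) x p -> uniq (x :: p) ->
  exists c0 c, [/\ unzip1 (c0 :: c) = x :: p,
    uniq (unzip2 (c0 :: c)),
    path (fun q r => joins ends q.2 q.1 r.1) c0 c,
    joins ends (last c0 c).2 (last c0 c).1 z
  & forall e, e \in unzip2 (c0 :: c) ->
      e = f \/ [/\ e \in B, (ends e).1 \in x :: p & (ends e).2 \in x :: p]].
Proof.
move=> fB fz; elim: p x fz => [|y p IH] x fz /=.
  by move=> _ _; exists (x, f), [::]; split=> // e; rewrite inE => /eqP->; left.
case/andP=> /existsP[e /andP[eB exy]] yp /andP[xp up].
have [c0 [c [c1 c2 pc cz ce]]] := IH y fz yp up.
have exy' : (x \in [:: (ends e).1; (ends e).2]) &&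
    [&& (ends e).1 \in [:: x; y] & (ends e).2 \in [:: x; y]].
  by move: exy; rewrite !inE => /orP[]/eqP->; rewrite !eqxx ?orbT.
exists (x, e), (c0 :: c); split=> //=.
- by move: c1 => /= ->.
- rewrite -[(_ \notin _) && _]/(uniq (e :: unzip2 (c0 :: c))).
  rewrite cons_uniq c2 andbT.
  apply/negP=> /ce[ef|[_ e1 e2]]; first by rewrite -ef eB in fB.
  move: exy' => /andP[+ _]; rewrite !inE => /orP[]/eqP xE.
    by rewrite xE e1 in xp.
  by rewrite xE e2 in xp.
- by move: c1 => [-> _]; rewrite exy.
- move=> g; rewrite inE => /predU1P[->|/ce[->|[gB g1 g2]]].
  + right; move: exy' => /and3P[_]; rewrite !inE => h1 h2.
    by split=> //; rewrite orbA (h1, h2).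
  + by left.
  + by right; split=> //; rewrite inE ?g1 ?g2 orbT.
Qed.

Lemma acyclic_bridge B e u v :
    acyclic B -> e \in B -> joins ends e u v ->
  ~~ connect (adjacent ends (B :\ e)) u v.
Proof.
move=> acB eB euv; apply/negP=> /connectP[p up vE]; apply: acB.
case: (shortenP up) vE => q uq qU _ vE.
have [||c0 [c [c1 c2 pc cz ce]]] := @close_path (B :\ e) e u q u _ _ uq qU.
- by rewrite !inE eqxx.
- by rewrite -vE joinsC.
exists (c0 :: c); last first.
  by move=> g /ce[->//|[]]; rewrite inE => /andP[].
rewrite /is_cycle c1 c2 qU /= rcons_path pc /=.
by case: c1 => -> _; rewrite cz.
Qed.

Lemma component_split B X u :
    subgraph ends X B ->
  let Y := [set x in X | connect (adjacent ends B) u x] in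
  exists B1 B2, [/\ #|B| = #|B1| + #|B2|, B1 \subset B, B2 \subset B,
    subgraph ends Y B1 & subgraph ends (X :\: Y) B2].
Proof.
move=> BX Y; pose C := [set e in B | (ends e).1 \in Y].
have cadj e : e \in B ->
    connect (adjacent ends B) u (ends e).1 =
    connect (adjacent ends B) u (ends e).2.
  move=> eB; apply: same_connect_r; first exact/sym_connect_sym/adjacent_sym.
  by apply: connect1; apply/existsP; exists e; rewrite eB joins_ends.
exists (B :&: C), (B :\: C); split; first by rewrite cardsID.
- exact: subsetIl.
- exact: subsetDl.
- move=> e; rewrite !inE => /and4P[eB _ e1 e1c].
  by have [_ e2] := BX e eB; rewrite e1 e1c e2 -cadj.
- move=> e; rewrite !inE => /andP[+ eB]; have [e1 e2] := BX e eB.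
  by rewrite e1 e2 -cadj // eB /= => ->.
Qed.

(** Deleting an edge [e] separates its two ends, so the induction hypothesis
    applies to each of the two sides. *)
Lemma acyclic_card_lt B X :
  acyclic B -> subgraph ends X B -> X != set0 -> #|B| < #|X|.
Proof.
have [n] := ubnP #|B|; elim: n B X => // n IH B X Bn acB BX X0.
have [B0|/set0Pn[e eB]] := eqVneq B set0; first by rewrite B0 cards0 card_gt0.
have BE : #|B| = #|B :\ e|.+1 by rewrite (cardsD1 e) eB.
have BX' : subgraph ends X (B :\ e).
  by move=> g; rewrite inE => /andP[_]; apply: BX.
have [e1 e2] := BX e eB.
have := acyclic_bridge acB eB (joins_ends e).
have := component_split (ends e).1 BX'.
set Y := [set x in X | _] => /= -[B1 [B2 [cB B1s B2s B1Y B2Y]]] e12.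
have lt (C : {set E}) (Z : {set V}) :
    C \subset B :\ e -> subgraph ends Z C -> Z != set0 -> #|C| < #|Z|.
  move=> Cs; apply: IH; last first.
    by apply: acyclicS acB; apply: subset_trans Cs (subD1set _ _).
  by apply: leq_ltn_trans (subset_leq_card Cs) _; rewrite -ltnS -BE.
have {}B1Y : #|B1| < #|Y|.
  by apply: lt => //; apply/set0Pn; exists (ends e).1; rewrite inE e1 connect0.
have {}B2Y : #|B2| < #|X :\: Y|.
  apply: lt => //; apply/set0Pn; exists (ends e).2.
  by rewrite !inE e2 (negbTE e12).
have YX : Y \subset X by apply/subsetP=> x; rewrite inE => /andP[].
rewrite BE cB -(cardsID Y X) (setIidPr YX) -addSn -addnS.
exact: leq_add.
Qed.

(** A disconnected forest would lose one edge in each of two parts. *)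
Lemma acyclic_card_connected B X :
    acyclic B -> subgraph ends X B -> #|X| <= #|B|.+1 ->
  {in X &, forall u v, connect (adjacent ends B) u v}.
Proof.
move=> acB BX cX u v uX vX; apply/negPn/negP=> uv.
have := component_split u BX.
set Y := [set x in X | _] => /= -[B1 [B2 [cB B1s B2s B1Y B2Y]]].
have {}B1Y : #|B1| < #|Y|.
  apply: acyclic_card_lt B1Y _; first exact: acyclicS acB.
  by apply/set0Pn; exists u; rewrite inE uX connect0.
have {}B2Y : #|B2| < #|X :\: Y|.
  apply: acyclic_card_lt B2Y _; first exact: acyclicS acB.
  by apply/set0Pn; exists v; rewrite !inE vX (negbTE uv).
have YX : Y \subset X by apply/subsetP=> x; rewrite inE => /andP[].
have := leq_add B1Y B2Y; move: cX.
rewrite -(cardsID Y X) (setIidPr YX) cB addSn addnS => h1 h2.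
by have := leq_trans h2 h1; rewrite ltnn.
Qed.

Lemma cycle_ends_subset c e :
  is_cycle ends c -> e \in unzip2 c ->
  ((ends e).1 \in unzip1 c) && ((ends e).2 \in unzip1 c).
Proof.
case/and4P=> _ _ _ cyc /mapP[p pc ->].
have := next_cycle cyc pc.
have p1 : p.1 \in unzip1 c by apply: map_f.
have n1 : (next c p).1 \in unzip1 c by apply: map_f; rewrite mem_next.
by case/orP=> /eqP->; rewrite p1 n1.
Qed.

(** A cycle has as many vertices as edges, so an injective choice of an endpoint
    for each edge hits every vertex. *)
Lemma cycle_endpoint_cover (o : E -> V) c :
    is_cycle ends c -> {in unzip2 c &, injective o} ->
    {in unzip2 c, forall e, o e = (ends e).1 \/ o e = (ends e).2} ->
  unzip1 c =i [seq o e | e <- unzip2 c].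
Proof.
move=> cyc oI oE; have /and4P[_ u1 u2 _] := cyc.
have oU : uniq [seq o e | e <- unzip2 c] by rewrite map_inj_in_uniq.
have [||_ oC] := @uniq_min_size _ _ (unzip1 c) oU; last exact: fsym oC.
  move=> x /mapP[e ec ->]; have /andP[e1 e2] := cycle_ends_subset cyc ec.
  by case: (oE e ec) => ->.
by rewrite !size_map.
Qed.

End ForestCounting.

(** * The digraph of labels and the link *)

Section LabelDigraph.

Variable G : LOG.
Hypotheses (G_LOF : is_LOF G) (G_injective : injective_LOG G).

Definition arc_tail (a : edge G * bool) : vertex G := lab a.1.
Definition arc_head (a : edge G * bool) : vertex G :=
  if a.2 then src a.1 else tgt a.1.

Definition unlabeled : {set vertex G} := [set x | x \notin codom (@lab G)].

(** If at most one arc leaves [X], the edges labeled by [X] form a tree on [X]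
    together with one pendant vertex [y] outside [X]. *)
Lemma label_cut_ge2 :
    (forall (V0 : {set vertex G}) (E0 : {set edge G}),
      is_subLOT V0 E0 -> boundary_reduced_on V0 E0) ->
  arcs_to_root arc_tail arc_head unlabeled 2 setT.
Proof.
move=> subLOTs X X0 XR; rewrite leqNgt ltnS; apply/negP=> /card_le1_eqP out1.
have [_ acT] := G_LOF.
have acE (B : {set edge G}) : acyclic (@log_ends G) B.
  by apply: (@acyclicS _ _ (@log_ends G) setT B) => //; apply: subsetT.
(* [EX] and [X] are in bijection since every vertex of [X] is a label. *)
pose EX := (@lab G) @^-1: X.
have cEX : #|EX| = #|X|.
  rewrite -(card_imset (mem EX) G_injective); congr #|pred_of_set _|.
  apply/setP=> x; apply/imsetP/idP => [[e + ->]|xX]; first by rewrite inE.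
  have : x \notin unlabeled by rewrite (disjointFr XR xX).
  by rewrite inE negbK => /codomP[e xE]; exists e; rewrite // inE -xE.
pose EI := EX :&: full_edges (@log_ends G) X.
have EIX : subgraph (@log_ends G) X EI.
  by move=> e; rewrite !inE => /and3P[_ -> ->].
have ltEI : #|EI| < #|EX| by rewrite cEX; apply: acyclic_card_lt.
have /subsetPn[e eX eI] : ~~ (EX \subset EI).
  by apply: contraL ltEI => /subset_leq_card; rewrite -leqNgt.
have out_edge g b : g \in EX -> arc_head (g, b) \notin X ->
    (g, b) \in out_arcs arc_tail arc_head setT X.
  by rewrite !inE /arc_tail /= => -> ->.
have [b eb] : exists b, arc_head (e, b) \notin X.
  move: eI; rewrite in_setI eX inE /= negb_and => /orP[h|h];
  by [exists true | exists false].
(* [(e, b)] is the only arc leaving [X]; [y] is its head, [z] the other end. *)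
have only g b' : g \in EX -> arc_head (g, b') \notin X -> (g, b') = (e, b).
  by move=> gX gb; apply: out1; apply: out_edge.
pose y := arc_head (e, b); pose z := arc_head (e, ~~ b).
have yX : y \notin X := eb.
have zX : z \in X.
  by apply/negPn/negP=> /(only e _ eX) []; case: (b).
have EIE : EI = EX :\ e.
  apply/setP=> g; rewrite in_setI in_setD1 andbC.
  have [gX|] := boolP (g \in EX); last by rewrite !andbF.
  rewrite !andbT; apply/idP/idP=> [gI|].
    by apply: contraNneq eI => <-; rewrite in_setI gX gI.
  apply: contraR; rewrite inE negb_and => /orP[h|h].
    by have [-> _] := only g true gX h.
  by have [-> _] := only g false gX h.
have eE : log_ends e = if b then (y, z) else (z, y).
  by rewrite /y /z /log_ends; case: (b).
have ends_in g : g \in EX -> g != e -> (src g \in X) && (tgt g \in X).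
  move=> gX ge; have : g \in EI by rewrite EIE !inE ge; rewrite inE in gX.
  by case/EIX=> /= -> ->.
have subY : subgraph (@log_ends G) (y |: X) EX.
  move=> g gX; have [->|ge] := eqVneq g e.
    by rewrite eE; case: (b); rewrite /= !in_setU1 eqxx zX orbT.
  by have /andP[h1 h2] := ends_in g gX ge; rewrite /= !in_setU1 h1 h2 !orbT.
have lot : is_subLOT (y |: X) EX.
  split.
    split=> //; first by apply/set0Pn; exists e.
    by move=> g; rewrite !inE => ->; rewrite orbT.
  split; first by split=> //; apply: acE.
    by apply/set0Pn; exists y; rewrite setU11.
  apply: acyclic_card_connected => //.
  by rewrite cardsU1 cEX -add1n leq_add2r; case: (_ \notin _).
have val1 : valency (@log_ends G) EX y = 1.
  have other g : g \in EX -> g != e -> (src g != y) && (tgt g != y).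
    move=> gX ge; have /andP[h1 h2] := ends_in g gX ge.
    by apply/andP; split; apply: contraNneq yX => <-.
  have zy : (z == y) = false by apply: contraNF yX => /eqP <-.
  have card_e (P : pred (edge G)) : {in EX, forall g, g != e -> ~~ P g} ->
      #|[set g in EX | P g]| = P e.
    move=> Pe; rewrite (cardsD1 e) in_set eX; apply/eqP.
    rewrite -[X in _ == X]addn0 eqn_add2l cards_eq0; apply/eqP/setP=> g.
    rewrite in_setD1 in_set in_set0; apply/and3P=> -[ge gX].
    exact/negP/Pe.
  rewrite /valency !card_e ?eE => [|g gX ge|g gX ge].
  - by case: (b); rewrite /= eqxx zy.
  - by case/andP: (other g gX ge).
  - by case/andP: (other g gX ge).
have [g gX yE] := subLOTs _ _ lot y (setU11 _ _) val1.
by move: yX; rewrite yE; rewrite inE in gX; rewrite gX.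
Qed.

(** The corner [(e, i)] joins the copy of [lab e] of sign [corner_lab_sign i] to
    the copy of sign [corner_end_sign i] of the source or target of [e],
    according to the sign at [lab e]. *)
Definition corner_lab_sign (i : 'I_4) : bool := (i : nat) \in [:: 0; 3].
Definition corner_end_sign (i : 'I_4) : bool := 1 < i.

Lemma corner_signs_inj i j :
  corner_lab_sign i = corner_lab_sign j ->
  corner_end_sign i = corner_end_sign j -> i = j.
Proof.
by case: i j => [[|[|[|[|//]]]] il] [[|[|[|[|//]]]] jl] //= _ _; apply: val_inj.
Qed.

Lemma joins_corner (e : edge G) (i : 'I_4) :
  joins (@link_ends G) (e, i) (lab e, corner_lab_sign i)
    (arc_head (e, corner_lab_sign i), corner_end_sign i).
Proof.
rewrite /joins /link_ends !(tnth_nth (src e, true)).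
by case: i => [[|[|[|[|//]]]] il] /=; rewrite !eqxx ?orbT.
Qed.

Definition selected (eps : vertex G -> bool) : {set vertex G * bool} :=
  [set (x, eps x) | x : vertex G].

Lemma mem_selected eps x b : ((x, b) \in selected eps) = (b == eps x).
Proof.
apply/imsetP/eqP => [[y _ [-> ->]] //|->]; by exists x.
Qed.

Lemma corner_selected eps (e : edge G) (i : 'I_4) :
  ((e, i) \in full_edges (@link_ends G) (selected eps)) =
  (corner_lab_sign i == eps (lab e)) &&
  (corner_end_sign i == eps (arc_head (e, corner_lab_sign i))).
Proof. by rewrite (joins_full_edges _ (joins_corner e i)) !mem_selected. Qed.

(** A selected corner is determined by the label of its edge.  In a cycle of
    selected corners, the labels thus exhaust the vertices, so the set [X] of
    these labels is closed under the partial function selected by [eps]. *)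
Lemma selected_link_is_forest (eps : vertex G -> bool) :
    (forall X, X != set0 -> [disjoint X & unlabeled] ->
      exists2 e : edge G, lab e \in X & arc_head (e, eps (lab e)) \notin X) ->
  full_link_is_forest (selected eps).
Proof.
move=> escape; split; first by move=> c; rewrite inE => /andP[].
case=> c cyc cS.
have sel p : p \in unzip2 c ->
    corner_lab_sign p.2 = eps (lab p.1) /\
    corner_end_sign p.2 = eps (arc_head (p.1, eps (lab p.1))).
  move=> /cS; case: p => e i; rewrite corner_selected => /andP[/eqP-> /eqP->].
  by [].
pose o (p : edge G * 'I_4) := (lab p.1, eps (lab p.1)).
have cover : unzip1 c =i [seq o p | p <- unzip2 c].
  apply: cycle_endpoint_cover (cyc) _ _ => [p q pc qc [/G_injective pq _]|p pc].
    have [p1 p2] := sel p pc; have [q1 q2] := sel q qc.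
    case: p q pq p1 p2 q1 q2 {pc qc} => [e i] [f j] /= <- p1 p2 q1 q2.
    by congr (_, _); apply: corner_signs_inj; rewrite ?p1 ?p2.
  case: p pc => e i /sel[/esym eps_e _]; rewrite /o eps_e.
  by case/orP: (joins_corner e i) => /eqP->; [left | right].
pose X := [set lab p.1 | p in unzip2 c].
have memX x : x \in X -> exists2 p, p \in unzip2 c & x = lab p.1.
  by case/imsetP=> p; exists p.
have [||e /memX[[e' i] pc /G_injective /= eE]] := escape X.
- case/and4P: cyc; case: c {cS sel cover memX} @X => // p c X _ _ _ _.
  by apply/set0Pn; exists (lab p.2.1); apply: imset_f; rewrite inE eqxx.
- rewrite disjoint_subset; apply/subsetP=> x /memX[p _ ->].
  by rewrite !inE negbK codom_f.
case/negP; rewrite {}eE {e}.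
have [/= <- _] := sel _ pc.
have : (arc_head (e', corner_lab_sign i), corner_end_sign i) \in unzip1 c.
  have /andP[] := cycle_ends_subset cyc pc.
  by case/orP: (joins_corner e' i) => /eqP->.
by rewrite cover => /mapP[p pc' [-> _]]; apply: imset_f.
Qed.

(** The signs are read off from a splitting of the arcs: [eps (lab e)] is [true]
    when the branching [F] uses the arc from [lab e] to [src e]. *)
Lemma label_cut_lbf :
  arcs_to_root arc_tail arc_head unlabeled 2 setT -> lbf_property G.
Proof.
case/edmonds_split=> F [_ F1 F2].
pose eps x := [exists e, (lab e == x) && ((e, true) \in F)].
have epsE e : eps (lab e) = ((e, true) \in F).
  apply/existsP/idP => [[g /andP[/eqP/G_injective->]] //|eF].
  by exists e; rewrite eqxx.
(* [F] and its complement both leave [[set lab e]], which has two outgoing arcs;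
   so [F] contains exactly one of the two. *)
have FE e b : ((e, b) \in F) = (b == eps (lab e)).
  have escape C : arcs_to_root arc_tail arc_head unlabeled 1 C ->
      exists b', (e, b') \in C.
    move=> C1.
    have /card_gt0P[[g b']] : 0 < #|out_arcs arc_tail arc_head C [set lab e]|.
      apply: C1; first by apply/set0Pn; exists (lab e); rewrite inE.
      by rewrite disjoints1 inE negbK codom_f.
    rewrite inE => /and3P[gC]; rewrite inE.
    by move=> /eqP/G_injective gE _; exists b'; rewrite -gE.
  have [b1 h1] := escape _ F1; have [b2] := escape _ F2.
  rewrite !inE andbT epsE.
  case: b1 b2 h1 => [] [] h1; rewrite ?h1 // => /negbTE h2;
    by case: b; rewrite ?h1 ?h2.
exists eps; split; apply: selected_link_is_forest => X X0 XR.
  have /card_gt0P[[e b]] := F1 X X0 XR.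
  by rewrite inE FE => /and3P[/eqP-> eX hX]; exists e.
have /card_gt0P[[e b]] := F2 X X0 XR.
rewrite !inE FE andbT => /and3P[bE eX hX]; exists e => //.
by case: b bE eX hX; rewrite /arc_tail /=; case: (eps _).
Qed.

End LabelDigraph.

Theorem theorem3p3 (G : LOG)
  (G_LOF : is_LOF G)
  (G_reduced : reduced G)
  (G_injective : injective_LOG G)
  (G_subLOTs : forall (V0 : {set vertex G}) (E0 : {set edge G}),
      is_subLOT V0 E0 -> boundary_reduced_on V0 E0) :
  lbf_property G.
Proof.
exact: label_cut_lbf G_injective (label_cut_ge2 G_LOF G_injective G_subLOTs).
Qed.
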